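(* Let $p$ be a prime, let $t$ be any integer, and let $m$ be a positive integer with $m\le p^{\nu_p(t)}$. Then $$\nu_p\left([x^{(p-1)m}]\,\ell(x)^t\right)=\nu_p(t)-\nu_p(m)-m.$$
   Context: $\ell(x)$ denotes the power series $\ell(x)=\sum_{i=0}^\infty(-1)^i\frac{x^i}{i+1}$ (the series of $\log(1+x)/x$). For a rational number $q$, $\nu_p(q)$ denotes the exponent of $p$ in $q$. For a power series $f(x)$, $[x^n]f(x)$ denotes the coefficient of $x^n$ in $f(x)$. *)

(* Defs.v *)
From HB Require Import structures.
From mathcomp Require Import all_boot all_order all_algebra.
From mathcomp Require Import boolp constructive_ereal.

Set Implicit Arguments.
Unset Strict Implicit.
Unset Printing Implicit Defensive.

Import Order.TTheory GRing.Theory Num.Theory.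

Local Open Scope ring_scope.

Record fps (R : Type) := FPS { fps_coef : nat -> R }.

Notation "''[x^' n ] f" := (fps_coef f n%N)
  (at level 10, n at level 200, f at level 8, format "''[x^' n ]  f").

Lemma fpsP (R : Type) (f g : fps R) :
  (forall n, fps_coef f n = fps_coef g n) -> f = g.
Proof. by case: f g => f [g] /= /funext ->. Qed.

HB.instance Definition _ (R : Type) := gen_eqMixin (fps R).
HB.instance Definition _ (R : Type) := gen_choiceMixin (fps R).

Section FpsRing.
Variable R : comNzRingType.
Implicit Types f g h : fps R.

Definition fps_zero : fps R := FPS (fun=> 0).
Definition fps_one : fps R := FPS (fun n => (n == 0%N)%:R).
Definition fps_opp f : fps R := FPS (fun n => - fps_coef f n).
Definition fps_add f g : fps R := FPS (fun n => fps_coef f n + fps_coef g n).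
Definition fps_mul f g : fps R :=
  FPS (fun n => \sum_(i < n.+1) fps_coef f i * fps_coef g (n - i)).

Lemma fps_addA : associative fps_add.
Proof. by move=> f g h; apply: fpsP => n /=; rewrite addrA. Qed.

Lemma fps_addC : commutative fps_add.
Proof. by move=> f g; apply: fpsP => n /=; rewrite addrC. Qed.

Lemma fps_add0 : left_id fps_zero fps_add.
Proof. by move=> f; apply: fpsP => n /=; rewrite add0r. Qed.

Lemma fps_addN : left_inverse fps_zero fps_opp fps_add.
Proof. by move=> f; apply: fpsP => n /=; rewrite addNr. Qed.

HB.instance Definition _ :=
  GRing.isZmodule.Build (fps R) fps_addA fps_addC fps_add0 fps_addN.

Definition fps_trunc N f : {poly R} := \poly_(i < N.+1) fps_coef f i.

Lemma coef_fps_trunc N f n : (n <= N)%N -> (fps_trunc N f)`_n = fps_coef f n.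
Proof. by move=> le_nN; rewrite coef_poly ltnS le_nN. Qed.

Lemma fps_mul_trunc N f g n : (n <= N)%N ->
  fps_coef (fps_mul f g) n = (fps_trunc N f * fps_trunc N g)`_n.
Proof.
move=> le_nN; rewrite coefM; apply: eq_bigr => i _.
rewrite !coef_fps_trunc //; first exact: leq_trans (leq_subr _ _) le_nN.
by rewrite (leq_trans _ le_nN) // -ltnS.
Qed.

Lemma fps_mulC : commutative fps_mul.
Proof.
by move=> f g; apply: fpsP => n; rewrite !(fps_mul_trunc _ _ (leqnn n)) mulrC.
Qed.

Lemma fps_mulA : associative fps_mul.
Proof.
move=> f g h; apply: fpsP => n; set T := fps_trunc n.
transitivity ((T f * (T g * T h))`_n).
  rewrite coefM; apply: eq_bigr => i _.
  rewrite (@fps_mul_trunc n) ?leq_subr // coef_fps_trunc //.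
  by rewrite -ltnS.
rewrite mulrA coefM; apply: eq_bigr => i _.
rewrite (@fps_mul_trunc n); last by rewrite -ltnS.
by rewrite coef_fps_trunc // leq_subr.
Qed.

Lemma fps_mul1 : left_id fps_one fps_mul.
Proof.
move=> f; apply: fpsP => n /=; rewrite big_ord_recl /= mul1r subn0.
by rewrite big1 ?addr0 // => i _; rewrite mul0r.
Qed.

Lemma fps_mulDl : left_distributive fps_mul fps_add.
Proof.
move=> f g h; apply: fpsP => n /=; rewrite -big_split /=.
by apply: eq_bigr => i _; rewrite mulrDl.
Qed.

Lemma fps_one_neq0 : fps_one != 0.
Proof.
apply/eqP => /(congr1 (fun f => fps_coef f 0)) /= /eqP.
by rewrite oner_eq0.
Qed.

HB.instance Definition _ := GRing.Zmodule_isComNzRing.Build (fps R)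
  fps_mulA fps_mulC fps_mul1 fps_mulDl fps_one_neq0.

End FpsRing.

Section FpsUnitRing.
Variable R : comUnitRingType.
Implicit Types f g : fps R.

Definition fps_unit : pred (fps R) :=
  fun f => fps_coef f 0 \is a GRing.unit.

(* The first n coefficients of the inverse of f, from
   g_n = f_0^-1 * ([n = 0] - \sum_(k < n) f_(n-k) g_k). *)
Fixpoint fps_inv_seq f (n : nat) : seq R :=
  if n is k.+1 then
    let s := fps_inv_seq f k in
    rcons s ((fps_coef f 0)^-1 *
      ((k == 0%N)%:R - \sum_(i < k) fps_coef f (k - i) * s`_i))
  else [::].

Definition fps_inv f : fps R :=
  if fps_unit f then FPS (fun n => (fps_inv_seq f n.+1)`_n) else f.

Lemma size_fps_inv_seq f n : size (fps_inv_seq f n) = n.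
Proof. by elim: n => //= n IHn; rewrite size_rcons IHn. Qed.

Lemma nth_fps_inv_seq f n i : (i < n)%N ->
  (fps_inv_seq f n)`_i = (fps_inv_seq f i.+1)`_i.
Proof.
elim: n => // n IHn; rewrite ltnS leq_eqVlt => /predU1P[-> //|lt_in].
by rewrite [LHS]nth_rcons size_fps_inv_seq lt_in IHn.
Qed.

Lemma fps_mulVr : {in fps_unit, left_inverse 1 fps_inv *%R}.
Proof.
move=> f Uf; have Uf0 : fps_coef f 0 \is a GRing.unit := Uf.
apply: fpsP => n; rewrite mulrC /fps_inv (Uf : fps_unit f) -[LHS]/(\sum_(i < n.+1) fps_coef f i *
  (fps_inv_seq f (n - i).+1)`_(n - i)).
rewrite (reindex_inj rev_ord_inj) big_ord_recr /= subnn subn0.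
rewrite nth_rcons size_fps_inv_seq ltnn eqxx mulVKr //.
rewrite [X in X + _ = _](_ : _ =
    \sum_(i < n) fps_coef f (n - i) * (fps_inv_seq f n)`_i) ?subrKC //.
apply: eq_bigr => i _; rewrite subSS subKn 1?ltnW //.
by rewrite [in RHS]nth_fps_inv_seq.
Qed.

Lemma fps_unitPl f g : g * f = 1 -> fps_unit f.
Proof.
move=> /(congr1 (fun h => fps_coef h 0)) /=.
rewrite big_ord1 /= => gf1; apply/unitrP.
by exists (fps_coef g 0); split; rewrite // mulrC.
Qed.

Lemma fps_inv_out : {in [predC fps_unit], fps_inv =1 id}.
Proof. by move=> f nUf; rewrite /fps_inv (negbTE (nUf : ~~ fps_unit f)). Qed.

HB.instance Definition _ := GRing.ComNzRing_hasMulInverse.Build (fps R)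
  fps_mulVr fps_unitPl fps_inv_out.

End FpsUnitRing.

(* log(1 + x) / x *)
Definition ell : fps rat := FPS (fun i => (-1) ^+ i / i.+1%:R).

Definition padic_val (p : nat) (q : rat) : \bar int :=
  if q == 0 then +oo%E
  else ((logn p `|numq q|)%:Z - (logn p `|denq q|)%:Z)%:E.

(* As padic_val p 0 = +oo, a bound m <= p ^ (padic_val p 0) is vacuous. *)
Definition natpowe (p : nat) (v : \bar int) : \bar rat :=
  match v with
  | EFin k => (p%:R ^ k)%:E
  | EPInf => +oo%E
  | ENInf => 0%:E
  end.

(* Main.v *)
Require Import Defs.
From HB Require Import structures.
From mathcomp Require Import all_boot all_order all_algebra.
From mathcomp Require Import boolp constructive_ereal.
From mathcomp Require Import zify ring.

Set Implicit Arguments.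
Unset Strict Implicit.
Unset Printing Implicit Defensive.

Import Order.TTheory GRing.Theory Num.Theory.

Local Open Scope ring_scope.

(** Give the monomial [q x^n] the weight [(p - 1) v_p(q) + n], so that [x^(p-1)]
    is on a par with [p].  All terms of [ell] have weight at least 0, and those
    of weight 0 are [1] and [c x^(p-1)] with [c = (-1)^(p-1) / p]; hence [ell]
    agrees with [g = 1 + c x^(p-1)] up to weight 1.  Raising to the power [p]
    improves a congruence by [p - 1], so [ell ^ t] and [g ^ t] agree up to weight
    [1 + (p - 1) v_p(t)].  The coefficient of [x^((p-1)m)] in [g ^ t] is
    [binom(t, m) c^m], of valuation [v_p(t) - v_p(m) - m] for
    [0 < m <= p^(v_p(t))], and the error is too small to affect it. *)

(* [valq p 0] has the junk value 0. *)
Definition valq (p : nat) (q : rat) : int :=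
  (logn p `|numq q|)%:Z - (logn p `|denq q|)%:Z.

(** * The [p]-adic valuation on the rationals and its ultrametric inequality *)

Section Valuation.
Variable p : nat.
Implicit Types (x y : rat) (a b : int).

(** Cross-multiplying with the reduced form gives an equality of integers, on which [logn] is
    additive; so valuations may be read off unreduced fractions. *)
Lemma valq_frac a b : a != 0 -> b != 0 ->
  valq p (a%:Q / b%:Q) = (logn p `|a|)%:Z - (logn p `|b|)%:Z.
Proof.
move=> a0 b0; set q := a%:Q / b%:Q.
have bQ : b%:Q != 0 by rewrite intr_eq0.
have q0 : q != 0 by rewrite mulf_neq0 ?invr_eq0 ?intr_eq0.
have nq0 : numq q != 0 by rewrite numq_eq0.
have dq0 := denq_neq0 q.
have e : a * denq q = numq q * b.
  apply/eqP; rewrite -(eqr_int rat) !intrM.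
  by rewrite -[a%:Q](divfK bQ) -/q -{1}(divq_num_den q) mulrAC divfK ?intr_eq0.
have : (logn p `|a| + logn p `|denq q| = logn p `|numq q| + logn p `|b|)%N.
  by rewrite -!lognM ?absz_gt0 // -!abszM e.
by rewrite /valq; lia.
Qed.

Lemma valq_int a : valq p a%:Q = (logn p `|a|)%:Z.
Proof. by rewrite /valq numq_int denq_int logn1 subr0. Qed.

Lemma valq_nat (n : nat) : valq p n%:R = (logn p n)%:Z.
Proof. exact: (valq_int n). Qed.

Lemma valqM x y : x != 0 -> y != 0 -> valq p (x * y) = valq p x + valq p y.
Proof.
move=> x0 y0; rewrite -{1}(divq_num_den x) -{1}(divq_num_den y).
have -> : (numq x)%:Q / (denq x)%:Q * ((numq y)%:Q / (denq y)%:Q) =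
   (numq x * numq y)%:Q / (denq x * denq y)%:Q.
  by rewrite !intrM; field; rewrite !intr_eq0 !denq_neq0.
rewrite valq_frac ?mulf_neq0 ?numq_eq0 ?denq_neq0 //.
by rewrite !abszM !lognM ?absz_gt0 ?numq_eq0 ?denq_neq0 // /valq; lia.
Qed.

Lemma valqN x : valq p (- x) = valq p x.
Proof. by rewrite /valq numqN denqN abszN. Qed.

Lemma valq1 : valq p 1 = 0.
Proof. by rewrite (valq_nat 1) logn1. Qed.

Lemma valqV x : x != 0 -> valq p x^-1 = - valq p x.
Proof.
move=> x0; have := @valqM x x^-1; rewrite invr_eq0 => /(_ x0 x0).
by rewrite divff // valq1; lia.
Qed.

Lemma valqX x n : x != 0 -> valq p (x ^+ n) = valq p x *+ n.
Proof.
move=> x0; elim: n => [|n IH]; first by rewrite valq1.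
by rewrite exprS valqM ?expf_neq0 // IH mulrS.
Qed.

Lemma logn_absz_add a b k : a + b != 0 ->
  (a == 0) || (k <= logn p `|a|)%N -> (b == 0) || (k <= logn p `|b|)%N ->
  (k <= logn p `|(a + b)%R|)%N.
Proof.
case: k => // k ab0.
(* For [p] not prime [logn p] vanishes, so a positive bound forces [a = b = 0], against
   [a + b != 0]. *)
have [pp|npp] := boolP (prime p); last first.
  have log0 n : logn p n = 0%N by rewrite lognE (negbTE npp).
  by rewrite !log0 !orbF => /eqP a0 /eqP b0; rewrite a0 b0 in ab0.
have dvd (c : int) : (c == 0) || (k < logn p `|c|)%N -> ((p ^ k.+1)%N %| c)%Z.
  have [->|c0 /=] := eqVneq c 0; first by rewrite dvdz0.
  by rewrite dvdzE /= pfactor_dvdn // absz_gt0.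
move=> /dvd da /dvd db.
by rewrite -pfactor_dvdn ?absz_gt0 //; have := rpredD da db; rewrite dvdzE.
Qed.

Lemma valq_add x y (k : int) : x + y != 0 ->
  (x == 0) || (k <= valq p x) -> (y == 0) || (k <= valq p y) ->
  k <= valq p (x + y).
Proof.
move=> xy0 hx hy.
set d := denq x * denq y.
have d0 : d != 0 by rewrite mulf_neq0 ?denq_neq0.
have frac (z : rat) (a : int) : z = a%:Q / d%:Q -> (z == 0) = (a == 0) /\
  (z != 0 -> valq p z = (logn p `|a|)%:Z - (logn p `|d|)%:Z).
  move=> ->; rewrite mulf_eq0 invr_eq0 !intr_eq0 (negbTE d0) orbF.
  by split=> // a0; rewrite valq_frac.
have ex : x = (numq x * denq y)%:Q / d%:Q.
  rewrite -{1}(divq_num_den x) /d !intrM; field.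
  by rewrite !intr_eq0 !denq_neq0.
have ey : y = (numq y * denq x)%:Q / d%:Q.
  rewrite -{1}(divq_num_den y) /d !intrM; field.
  by rewrite !intr_eq0 !denq_neq0.
have exy : x + y = (numq x * denq y + numq y * denq x)%:Q / d%:Q.
  by rewrite intrD mulrDl -ex -ey.
move: (frac _ _ ex) (frac _ _ ey) (frac _ _ exy).
move: (numq x * denq y) (numq y * denq x) => a b [xa va] [yb vb] [xyab vab].
have ab0 : a + b != 0 by rewrite -xyab.
rewrite vab //.
(* Over the common denominator [d] the bound on numerators is [k + logn p |d|]: vacuous if
   nonpositive, otherwise a natural number [j] fit for [logn_absz_add]. *)
have [kd|kd] := lerP (k + (logn p `|d|)%:Z) 0; first lia.
have [j kj] : exists j : nat, k = j%:Z - (logn p `|d|)%:Z.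
  by exists (absz (k + (logn p `|d|)%:Z)); lia.
rewrite {k}kj xa yb in hx hy kd *.
rewrite lerD2r lez_nat; apply: logn_absz_add => //.
- case/orP: hx => [-> //|hx]; case: eqVneq => //= a0.
  by rewrite va ?xa // in hx; lia.
- case/orP: hy => [-> //|hy]; case: eqVneq => //= b0.
  by rewrite vb ?yb // in hy; lia.
Qed.

Lemma valq_add_lt x y : x != 0 -> (y == 0) || (valq p x < valq p y) ->
  x + y != 0 /\ valq p (x + y) = valq p x.
Proof.
move=> x0 hy; have [->|y0] := eqVneq y 0; first by rewrite addr0.
rewrite (negbTE y0) /= in hy.
have xy0 : x + y != 0.
  apply: contraTneq hy => /eqP; rewrite addr_eq0 => /eqP ->.
  by rewrite valqN ltxx.
split=> //; apply/eqP; rewrite eq_le; apply/andP; split; last first.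
  by apply: valq_add; rewrite ?lexx ?(ltW hy) ?orbT.
(* If [x + y] had valuation above that of [x], so would [x = (x + y) - y]. *)
rewrite leNgt; apply/negP => lt.
have : valq p x + 1 <= valq p (x + y - y).
  apply: valq_add; rewrite ?addrK //; first by apply/orP; right; lia.
  by rewrite valqN; apply/orP; right; lia.
by rewrite addrK; lia.
Qed.

Lemma padic_valE x : x != 0 -> padic_val p x = (valq p x)%:E.
Proof. by rewrite /padic_val => /negbTE ->. Qed.

End Valuation.

Lemma fps_coefD (f g : fps rat) n :
  fps_coef (f + g) n = fps_coef f n + fps_coef g n.
Proof. by []. Qed.

Lemma fps_coefB (f g : fps rat) n :
  fps_coef (f - g) n = fps_coef f n - fps_coef g n.
Proof. by []. Qed.

Lemma fps_coefM (f g : fps rat) n :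
  fps_coef (f * g) n = \sum_(i < n.+1) fps_coef f i * fps_coef g (n - i).
Proof. by []. Qed.

Lemma fps_coefMn (f : fps rat) j n : fps_coef (f *+ j) n = fps_coef f n *+ j.
Proof. by elim: j => // j IH; rewrite !mulrS -IH. Qed.

(** * The weighted filtration *)

(* The monomial [q x^n] has weight at least [k]. *)
Definition wge (p : nat) (k : int) (n : nat) (q : rat) : bool :=
  (q == 0) || (k <= (p%:Z - 1) * valq p q + n%:Z).

Definition fil (p : nat) (k : int) (f : fps rat) : Prop :=
  forall n, wge p k n (fps_coef f n).

Section Filtration.
Variable p : nat.
Hypothesis pp : prime p.
Implicit Types (f g : fps rat) (k l : int) (n : nat).

Let p2 : (1 < p)%N := prime_gt1 pp.

Lemma wge0 k n : wge p k n 0. Proof. by rewrite /wge eqxx. Qed.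

Lemma wgeD k n x y : wge p k n x -> wge p k n y -> wge p k n (x + y).
Proof.
rewrite /wge; case: (eqVneq x 0) => [-> _|x0]; first by rewrite add0r.
case: (eqVneq y 0) => [->|y0]; first by rewrite addr0 (negbTE x0).
case: (eqVneq (x + y) 0) => //= xy0 hx hy.
have := @valq_add p x y (Num.min (valq p x) (valq p y)) xy0.
rewrite !ge_min !lexx !orbT => /(_ isT isT).
by case: (leP (valq p x) (valq p y)); nia.
Qed.

Lemma wgeN k n x : wge p k n (- x) = wge p k n x.
Proof. by rewrite /wge oppr_eq0 valqN. Qed.

Lemma wgeM k l m n x y :
  wge p k m x -> wge p l n y -> wge p (k + l) (m + n) (x * y).
Proof.
rewrite /wge mulf_eq0; case: (eqVneq x 0) => //= x0.
by case: (eqVneq y 0) => //= y0; rewrite valqM // PoszD; lia.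
Qed.

Lemma wge_le k l n x : l <= k -> wge p k n x -> wge p l n x.
Proof. by move=> lk /orP[/eqP->|h]; rewrite ?wge0 // /wge; apply/orP; right; lia. Qed.

Lemma wge_sum k n I (r : seq I) (P : pred I) (F : I -> rat) :
  (forall i, P i -> wge p k n (F i)) -> wge p k n (\sum_(i <- r | P i) F i).
Proof.
by move=> h; elim/big_ind: _ => [||i /h//]; [exact: wge0 | move=> x y; exact: wgeD].
Qed.

Lemma wge_nat k n x (j : nat) : (p %| j)%N -> wge p k n x ->
  wge p (k + (p%:Z - 1)) n (x *+ j).
Proof.
move=> pj; rewrite /wge mulrn_eq0; case: (posnP j) => //= j0.
case: (eqVneq x 0) => //= x0.
rewrite -mulr_natr valqM ?pnatr_eq0 -?lt0n // valq_nat.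
have : (0 < logn p j)%N by rewrite logn_gt0 mem_primes pp j0.
by nia.
Qed.

Lemma fil0 k : fil p k 0. Proof. by move=> n; exact: wge0. Qed.

Lemma filD k f g : fil p k f -> fil p k g -> fil p k (f + g).
Proof. by move=> hf hg n; apply: wgeD. Qed.

Lemma filN k f : fil p k f -> fil p k (- f).
Proof. by move=> hf n; rewrite [fps_coef _ n]/(- fps_coef f n) wgeN. Qed.

Lemma filM k l f g : fil p k f -> fil p l g -> fil p (k + l) (f * g).
Proof.
move=> hf hg n; apply: wge_sum => i _.
have le_in : (i <= n)%N by rewrite -ltnS.
by have := wgeM (hf i) (hg (n - i)%N); rewrite subnKC.
Qed.

Lemma filM0l k f g : fil p 0 f -> fil p k g -> fil p k (f * g).
Proof. by rewrite -{2}[k]add0r; exact: filM. Qed.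

Lemma fil_le k l f : l <= k -> fil p k f -> fil p l f.
Proof. by move=> lk hf n; apply: wge_le (hf n). Qed.

Lemma fil1 : fil p 0 1.
Proof.
move=> [|n]; last exact: wge0.
by rewrite /wge [fps_coef _ _]/(1 : rat) valq1 mulr0 lexx orbT.
Qed.

Lemma filX k f n : fil p k f -> fil p (k *+ n) (f ^+ n).
Proof.
move=> hf; elim: n => [|n IH]; first exact: fil1.
by rewrite exprS mulrS; apply: filM.
Qed.

Lemma filX0 f n : fil p 0 f -> fil p 0 (f ^+ n).
Proof. by move=> /(@filX _ _ n); rewrite mul0rn. Qed.

Lemma fil_sum k I (r : seq I) (P : pred I) (F : I -> fps rat) :
  (forall i, P i -> fil p k (F i)) -> fil p k (\sum_(i <- r | P i) F i).
Proof.
by move=> h; elim/big_ind: _ => [||i /h//]; [exact: fil0 | move=> x y; exact: filD].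
Qed.

Lemma fil_nat k f (j : nat) : (p %| j)%N -> fil p k f ->
  fil p (k + (p%:Z - 1)) (f *+ j).
Proof. by move=> pj hf n; rewrite fps_coefMn; apply: wge_nat. Qed.

(** [f - g] divides the difference of powers, with a cofactor of weight at least 0. *)
Lemma fil_sub_exp k f g n : fil p 0 f -> fil p 0 g -> fil p k (f - g) ->
  fil p k (f ^+ n - g ^+ n).
Proof.
move=> hf hg hfg; rewrite subrXX mulrC; apply: filM0l => //.
by apply: fil_sum => i _; apply: filM0l; apply: filX0.
Qed.

(* Each binomial coefficient 'C(p, i), 0 < i < p, gains weight p - 1, and
   (f - g)^p has weight at least k p >= k + (p - 1). *)
Lemma fil_sub_expp k f g : 1 <= k -> fil p 0 g -> fil p k (f - g) ->
  fil p (k + (p%:Z - 1)) (f ^+ p - g ^+ p).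
Proof.
move=> k1 hg; set h := f - g => hh.
have -> : f = g + h by rewrite addrC subrK.
rewrite exprDn big_ord_recl /= subn0 mulr1 bin0 mulr1n addrAC subrr add0r.
apply: fil_sum => i _; rewrite /bump /= add1n.
have [ip|ip] := ltnP i.+1 p.
  apply: fil_nat; first by rewrite prime_dvd_bin.
  apply: filM0l; first exact: filX0.
  (* Here [k >= 1] ensures that the weight [k (i + 1)] of the power of [h] is at least [k]. *)
  apply: fil_le (@filX _ _ i.+1 hh).
  by rewrite -mulr_natr; nia.
have -> : i.+1 = p by have := ltn_ord i; lia.
rewrite subnn mul1r binn mulr1n; apply: fil_le (@filX _ _ p hh).
by rewrite -mulr_natr natz; nia.
Qed.

Lemma fil_sub_exppn f g v : fil p 0 f -> fil p 0 g -> fil p 1 (f - g) ->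
  fil p (1 + v%:Z * (p%:Z - 1)) (f ^+ (p ^ v) - g ^+ (p ^ v)).
Proof.
move=> hf hg hfg; elim: v => [|v IH]; first by rewrite mul0r addr0.
rewrite expnSr !exprM.
have -> : 1 + v.+1%:Z * (p%:Z - 1) = (1 + v%:Z * (p%:Z - 1)) + (p%:Z - 1) by lia.
by apply: fil_sub_expp => //; [nia | apply: filX0].
Qed.

Lemma fil_inv f : fps_coef f 0 = 1 -> fil p 0 f -> fil p 0 f^-1.
Proof.
move=> f0 hf; have Uf : f \is a GRing.unit.
  by rewrite -[_ \is a _]/(fps_coef f 0 \is a GRing.unit) f0 unitr1.
(* Extracting the term [i = 0] of [f * f^-1 = 1] involves no division since the constant term is 1;
   strong induction on [n] then bounds the weights. *)
have e n : fps_coef f^-1 n = fps_coef (1 : fps rat) n -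
    \sum_(i < n) fps_coef f i.+1 * fps_coef f^-1 (n - i.+1).
  rewrite -(divrr Uf) fps_coefM.
  by rewrite big_ord_recl f0 mul1r subn0 /= addrK.
move=> n; elim/ltn_ind: n => n IH; rewrite e; apply: wgeD; first exact: fil1.
rewrite wgeN; apply: wge_sum => i _.
have lt_in := ltn_ord i.
have := @wgeM 0 0 i.+1 (n - i.+1) _ _ (hf i.+1) (IH _ _).
by rewrite subnKC // addr0; apply; lia.
Qed.

Lemma fil_sub_inv k f g : f \is a GRing.unit -> g \is a GRing.unit ->
  fil p 0 f^-1 -> fil p 0 g^-1 -> fil p k (f - g) -> fil p k (f^-1 - g^-1).
Proof.
move=> Uf Ug hf hg hfg.
have -> : f^-1 - g^-1 = f^-1 * (g^-1 * - (f - g)).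
  by rewrite opprB mulrBr mulVr // mulrBr mulr1 mulrCA mulVr // mulr1.
by do 2![apply: filM0l => //]; apply: filN.
Qed.

Lemma fil_sub_exprz f g (t : int) : t != 0 ->
  fps_coef f 0 = 1 -> fps_coef g 0 = 1 ->
  fil p 0 f -> fil p 0 g -> fil p 1 (f - g) ->
  fil p (1 + (logn p `|t|)%:Z * (p%:Z - 1)) (f ^ t - g ^ t).
Proof.
move=> t0 f0 g0 hf hg hfg.
have nat_case n : (0 < n)%N ->
    fil p (1 + (logn p n)%:Z * (p%:Z - 1)) (f ^+ n - g ^+ n).
  (* The power [p ^ v] produces the whole gain in weight; raising further to the cofactor [q]
     preserves the congruence. *)
  move=> n0; have /dvdnP[q] := pfactor_dvdnn p n; move: (logn p n) => v ->.
  rewrite mulnC (exprM f) (exprM g).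
  by apply: fil_sub_exp; [exact: filX0.. | exact: fil_sub_exppn].
have unitX (h : fps rat) n : fps_coef h 0 = 1 -> fps_coef (h ^+ n) 0 = 1.
  move=> h0; elim: n => // n IH; rewrite exprS.
  by rewrite fps_coefM big_ord1 h0 IH mul1r.
have Uh (h : fps rat) n : fps_coef h 0 = 1 -> h ^+ n \is a GRing.unit.
  by move=> /unitX h0; rewrite -[_ \is a _]/(fps_coef _ 0 \is a GRing.unit) h0 unitr1.
case: t t0 => n n0; first by apply: nat_case; case: n n0.
rewrite !NegzE -!exprnN abszN.
apply: fil_sub_inv; rewrite ?Uh //; last exact: nat_case.
- by apply: fil_inv; [exact: unitX | exact: filX0].
- by apply: fil_inv; [exact: unitX | exact: filX0].
Qed.

End Filtration.

(** * Binomial series *)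

(** The generalized binomial coefficient [binom(t, m)], in product form to allow negative [t]. *)
Definition binq (t : int) (m : nat) : rat :=
  \prod_(i < m) ((t - i%:Z)%:Q / i.+1%:R).

Lemma binqS t m : binq t m.+1 = binq t m * ((t - m%:Z)%:Q / m.+1%:R).
Proof. by rewrite /binq big_ord_recr. Qed.

Lemma binq0 t : binq t 0 = 1.
Proof. by rewrite /binq big_ord0. Qed.

(** Absorption: it yields Pascal's rule, and in [valq_binq] it isolates the ratio that carries the
    whole valuation. *)
Lemma binq_absorb (t : int) m :
  binq (t + 1) m.+1 = (t + 1)%:Q / m.+1%:R * binq t m.
Proof.
elim: m => [|m IH]; first by rewrite binqS !binq0 subr0 mul1r mulr1.
rewrite binqS IH binqS.
have -> : t + 1 - m.+1%:Z = t - m%:Z by lia.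
by field; rewrite nat1r -natrD !pnatr_eq0.
Qed.

Lemma binq_pascal (t : int) m : binq (t + 1) m.+1 = binq t m.+1 + binq t m.
Proof.
rewrite binq_absorb binqS intrB intrD -[m%:~R]/(m%:R).
by field; rewrite nat1r pnatr_eq0.
Qed.

(** The expansion of [(1 + c x^d) ^ t], as [binom_seriesE] shows for [d > 0]. *)
Definition binom_series (c : rat) (d : nat) (t : int) : fps rat :=
  FPS (fun n => if (d %| n)%N then binq t (n %/ d) * c ^+ (n %/ d) else 0).

Definition fps_monom (c : rat) (d : nat) : fps rat :=
  FPS (fun n => if n == d then c else 0).

Lemma fps_coef_mulr_monom (c : rat) d f n :
  fps_coef (f * fps_monom c d) n = if (d <= n)%N then fps_coef f (n - d) * c else 0.
Proof.
rewrite mulrC fps_coefM /=.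
case: leqP => dn; last first.
  by rewrite big1 // => i _; rewrite ifN ?mul0r //; have := ltn_ord i; lia.
have dn' : (d < n.+1)%N by [].
rewrite (bigD1 (Ordinal dn')) //= eqxx big1 ?addr0 1?mulrC // => i.
by rewrite -val_eqE /= => /negbTE ->; rewrite mul0r.
Qed.

Section BinomialSeries.
Variables (c : rat) (d : nat).
Hypothesis d_gt0 : (0 < d)%N.

Let g := 1 + fps_monom c d.

Lemma binom_series0 : binom_series c d 0 = 1.
Proof.
apply: fpsP => -[|n] /=; first by rewrite dvdn0 div0n binq0 mulr1.
case: dvdnP => // -[[|k] e]; first by lia.
by rewrite e mulnK // /binq big_ord_recl subr0 !mul0r.
Qed.

(** Pascal's rule at each multiple of [d]; below [d] only the constant term survives. *)
Lemma binom_seriesS t : binom_series c d (t + 1) = binom_series c d t * g.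
Proof.
apply: fpsP => n; rewrite /g mulrDr mulr1.
rewrite fps_coefD fps_coef_mulr_monom /=.
case: (leqP d n) => dn; last first.
  rewrite addr0; case: ifP => // /dvdnP[[|k] e]; last by lia.
  by rewrite e div0n !binq0.
rewrite dvdn_subl //; case: ifP => [/dvdnP[[|k] e]|]; first by lia.
  by rewrite e mulSn addKn -mulSn !mulnK // binq_pascal exprSr mulrDl !mulrA.
by rewrite mul0r addr0.
Qed.

Lemma coef0_1Dmonom : fps_coef g 0 = 1.
Proof. by rewrite fps_coefD /= ifN ?addr0 //; lia. Qed.

Lemma unit_1Dmonom : g \is a GRing.unit.
Proof.
by rewrite -[_ \is a _]/(fps_coef g 0 \is a GRing.unit) coef0_1Dmonom unitr1.
Qed.

Lemma binom_seriesE t : g ^ t = binom_series c d t.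
Proof.
have add s n : binom_series c d s * g ^+ n = binom_series c d (s + n%:Z).
  elim: n => [|n IH]; first by rewrite mulr1 addr0.
  by rewrite exprSr mulrA IH -binom_seriesS; congr binom_series; lia.
case: t => n; first by have := add 0 n; rewrite binom_series0 mul1r add0r.
(* Climbing [n + 1] steps from exponent [-(n + 1)] reaches the series 1, so the series at [-(n + 1)]
   is the inverse of [g ^+ n.+1]. *)
have := add (- n.+1%:Z) n.+1; rewrite addNr binom_series0 NegzE -exprnN.
by move=> /(canRL (mulrK (unitrX n.+1 unit_1Dmonom))) ->; rewrite mul1r.
Qed.

End BinomialSeries.

(** * Valuations of the binomial coefficients *)

Lemma valq_sub_small p (t i : int) (j := `|i|%N) : prime p -> t != 0 -> i != 0 ->
  (j < p ^ logn p `|t|)%N -> t - i != 0 /\ valq p (t - i)%:Q = valq p i%:Q.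
Proof.
move=> pp t0 i0 jlt.
(* Since [p ^ logn p j <= j], the valuation of [i] is below that of [t], so [i] dominates the
   difference. *)
have lij : (logn p j < logn p `|t|)%N.
  rewrite -(ltn_exp2l _ _ (prime_gt1 pp)); apply: leq_ltn_trans jlt.
  by apply: dvdn_leq (pfactor_dvdnn _ _); rewrite absz_gt0.
have [] := @valq_add_lt p (- i%:Q) t%:Q.
- by rewrite oppr_eq0 intr_eq0.
- by rewrite valqN !valq_int ltz_nat lij orbT.
- by rewrite valqN addrC -intrB intr_eq0.
Qed.

Lemma valq_binq p (t : int) m : prime p -> t != 0 -> (0 < m)%N ->
  (m <= p ^ logn p `|t|)%N ->
  binq t m != 0 /\ valq p (binq t m) = (logn p `|t|)%:Z - (logn p m)%:Z.
Proof.
move=> pp t0; case: m => // m _ mt.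
rewrite -(subrK 1 t) binq_absorb subrK.
(* By absorption [binom(t, m + 1)] is [t / (m + 1)] times this coefficient, whose factors
   [(t - i) / i] with [0 < i <= m] all have valuation 0. *)
have [b0 vb] : binq (t - 1) m != 0 /\ valq p (binq (t - 1) m) = 0.
  elim: m mt => [|m IH] mt; first by rewrite binq0 valq1.
  have [|b0 vb] := IH; first by lia.
  have [||tm0 vtm] := @valq_sub_small p t m.+1 pp t0; [by [] | by lia |].
  have e : t - 1 - m%:Z = t - m.+1%:Z by lia.
  rewrite binqS e; set r := (_ / _ : rat).
  have m0 : (m.+1%:R : rat) != 0 by rewrite pnatr_eq0.
  have tm0' : (t - m.+1%:Z)%:Q != 0 by rewrite intr_eq0.
  rewrite !mulf_neq0 ?invr_eq0 // !valqM ?mulf_neq0 ?invr_eq0 //.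
  by rewrite vb vtm valqV // !valq_int subrr addr0.
have m0 : (m.+1%:R : rat) != 0 by rewrite pnatr_eq0.
have tQ0 : t%:Q != 0 by rewrite intr_eq0.
rewrite !mulf_neq0 ?invr_eq0 // !valqM ?mulf_neq0 ?invr_eq0 //.
by rewrite vb valqV // valq_int valq_nat addr0.
Qed.

(** * Weights of the coefficients of [ell] *)

Lemma expn_bernoulli_lt p e : (1 < p)%N -> (1 < e)%N -> ((p - 1) * e + 1 < p ^ e)%N.
Proof.
(* At [e = 1] there is equality, so the induction starts at [e = 2], where the claim amounts to
   [(p - 1)^2 > 0]. *)
move=> p1; elim: e => // -[|[|e]] IH _ //; first by rewrite expnS expn1; nia.
have {}IH := IH isT; rewrite expnS.
have : (p * ((p - 1) * e.+2 + 1) < p * p ^ e.+2)%N by rewrite ltn_pmul2l //; lia.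
by nia.
Qed.

(* The coefficients 1 / (n + 1) of weight 0 are those with n = 0 and n = p - 1:
   a pole of order e forces p^e <= n + 1, and (p - 1) e < p^e - 1 for e > 1. *)
Lemma fil_ell p : prime p ->
  fil p 1 (ell - (1 + fps_monom ((-1) ^+ (p - 1) / p%:R) (p - 1))).
Proof.
move=> pp n; have p1 := prime_gt1 pp.
rewrite fps_coefB fps_coefD /=.
case: (eqVneq n (p - 1)%N) => [->|np].
  rewrite (_ : (p - 1 == 0)%N = false); last by lia.
  by rewrite add0r (_ : (p - 1).+1 = p) ?subrr ?wge0 //; lia.
case: n np => [|n] np; first by rewrite addr0 divr1 subrr wge0.
rewrite !addr0 ?subr0 /wge.
have n0 : (n.+2%:R : rat) != 0 by rewrite pnatr_eq0.
rewrite valqM ?invr_eq0 ?signr_eq0 // valqV // valq_nat.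
have -> : valq p ((-1) ^+ n.+1) = 0.
  by rewrite -signr_odd; case: (odd _); rewrite ?expr1 ?valqN valq1.
apply/orP; right.
set e := logn p n.+2.
suff : ((p - 1) * e < n.+1)%N by nia.
have pe : (p ^ e <= n.+2)%N by apply: dvdn_leq (pfactor_dvdnn _ _).
(* For [e = 1], the bound [p <= n + 2] is strict because the index [n + 1] differs from [p - 1]. *)
case: e pe => [|[|e]] pe; [by rewrite muln0 | by rewrite expn1 in pe; lia |].
by have := @expn_bernoulli_lt p e.+2 p1 isT; lia.
Qed.

Theorem theorem1p1 (p : nat) (t : int) (m : nat) :
  prime p -> (0 < m)%N ->
  (m%:R%:E <= natpowe p (padic_val p t%:Q))%E ->
  padic_val p ('[x^ (p - 1) * m] (ell ^ t)) =
    (padic_val p t%:Q - padic_val p m%:Q - m%:Z%:E)%E.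
Proof.
move=> pp m0 hm; have p1 := prime_gt1 pp.
have mQ0 : m%:Q != 0 by rewrite intr_eq0; lia.
rewrite (padic_valE _ mQ0) valq_int.
have [t0|t0] := eqVneq t 0.
  (* For [t = 0] both sides are [+oo]: the series 1 has coefficient 0 at a positive index. *)
  rewrite t0 /= (_ : ((p - 1) * m == 0)%N = false); last by nia.
  by rewrite /padic_val eqxx.
have tQ0 : t%:Q != 0 by rewrite intr_eq0.
rewrite (padic_valE _ tQ0) valq_int; move: hm.
rewrite (padic_valE _ tQ0) valq_int /= lee_fin -exprnP -natrX ler_nat => hm.
set c : rat := (-1) ^+ (p - 1) / p%:R.
set g := 1 + fps_monom c (p - 1).
have pQ0 : (p%:R : rat) != 0 by rewrite pnatr_eq0; lia.
have c0 : c != 0 by rewrite mulf_neq0 ?signr_eq0 ?invr_eq0.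
have vc : valq p c = -1.
  rewrite valqM ?signr_eq0 ?invr_eq0 // valqV // valq_nat logn_prime // eqxx.
  by rewrite -signr_odd; case: (odd _); rewrite ?expr1 ?valqN valq1.
have d0 : (0 < p - 1)%N by lia.
(* The valuation -1 of [c] costs weight [p - 1], which the exponent [p - 1] exactly repays. *)
have hg : fil p 0 g.
  apply: filD => //; first exact: fil1.
  move=> n; rewrite /=; case: eqP => [->|_]; last exact: wge0.
  by rewrite /wge vc; apply/orP; right; lia.
have hd := fil_ell pp; rewrite -/c -/g in hd.
have hl : fil p 0 ell.
  by rewrite -(subrK g ell); apply: filD => //; apply: fil_le hd.
have l0 : fps_coef ell 0 = 1 by rewrite /= divr1.
have gE : fps_coef (g ^ t) ((p - 1) * m) = binq t m * c ^+ m.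
  by rewrite binom_seriesE //= dvdn_mulr // mulKn.
have := @fil_sub_exprz p pp ell g t t0 l0 (coef0_1Dmonom c d0) hl hg hd.
move: (ell ^ t) (g ^ t) gE => F G GE /(_ ((p - 1) * m)%N).
rewrite fps_coefB GE; move: (fps_coef F _) => a.
have [bq0 vbq] := valq_binq pp t0 m0 hm.
set b := binq t m * c ^+ m => hab.
have b0 : b != 0 by rewrite mulf_neq0 ?expf_neq0.
have vb : valq p b = (logn p `|t|)%:Z - (logn p m)%:Z - m%:Z.
  by rewrite valqM ?expf_neq0 // valqX // vbq vc mulNrn natz.
have [] := @valq_add_lt p b (a - b) b0.
  case/orP: hab => [-> //|hab]; apply/orP; right.
  have e : ((p - 1) * m)%N%:Z = (p%:Z - 1) * m%:Z by nia.
  rewrite vb e in hab *; move: (valq p _) hab => w hab.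
  (* Cancelling [p - 1] gives the error [a - b] valuation [w > v_p(t) - m], and [v_p(t) - m] is at
     least the valuation of [b] as [v_p(m) >= 0]. *)
  have : 0 < (p%:Z - 1) * (w + m%:Z - (logn p `|t|)%:Z) by lia.
  by rewrite pmulr_rgt0; lia.
by rewrite addrC subrK => a0 va; rewrite padic_valE // va vb.
Qed.
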